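(* Let $P$ and $Q$ be Interface Automata with common input alphabet $I$ and common output alphabet $O$, and let $p\in P$, $q\in Q$. Then $p\sqsubseteq_{\mathrm{IA}} q$ if and only if $[\![p]\!]\sqsubseteq_{\mathrm{MIA}}[\![q]\!]$.
   Context: An Interface Automaton (IA) is $P=(P,I,O,\rightarrow_P)$ with states $P$, disjoint action sets $I,O$ not containing $\tau$, and $\rightarrow_P\subseteq P\times(I\cup O\cup\{\tau\})\times P$ input-deterministic (for $a\in I$, $p\xrightarrow{a}p'$ and $p\xrightarrow{a}p''$ imply $p'=p''$). IA weak transitions: $p\stackrel{\epsilon}{\Rightarrow}p'$ iff $p(\xrightarrow{\tau})^*p'$; for $o\in O$, $p\stackrel{o}{\Rightarrow}p'$ iff $\exists p''.\,p\stackrel{\epsilon}{\Rightarrow}p''\xrightarrow{o}p'$; $\hat\tau=\epsilon$, $\hat a=a$. $p\sqsubseteq_{\mathrm{IA}}q$ iff some $\mathcal R\subseteq P\times Q$ containing $(p,q)$ satisfies for all $(p,q)\in\mathcal R$: (i) $q\xrightarrow{a}q'$, $a\in I$, implies $p\xrightarrow{a}p'$ with $(p',q')\in\mathcal R$; (ii) $p\xrightarrow{\alpha}p'$, $\alpha\in O\cup\{\tau\}$, implies $q\stackrel{\hat\alpha}{\Rightarrow}q'$ with $(p',q')\in\mathcal R$. A Modal Interface Automaton (MIA) is $(P,I,O,\longrightarrow_P,\dashrightarrow_P)$ with $I,O$ disjoint, must-relation $\longrightarrow_P\subseteq P\times(I\cup O)\times(2^P\setminus\{\emptyset\})$, may-relation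 $\dashrightarrow_P\subseteq P\times(I\cup O\cup\{\tau\})\times P$, syntactic consistency ($p\xrightarrow{a}P'$ implies $p\stackrel{a}{\dashrightarrow}p'$ for all $p'\in P'$), and for all $i\in I$: (a) $p\xrightarrow{i}P'$, $p\xrightarrow{i}P''$ imply $P'=P''$; (b) $p\stackrel{i}{\dashrightarrow}p'$ implies $p\xrightarrow{i}P'$ for some $P'\ni p'$. $p\xrightarrow{a}p'$ abbreviates $p\xrightarrow{a}\{p'\}$. Weak may: $p\stackrel{\epsilon}{\Longrightarrow}p'$ iff $p(\stackrel{\tau}{\dashrightarrow})^*p'$; $p\stackrel{\alpha}{\Longrightarrow}p'$ iff $\exists p''.\,p\stackrel{\epsilon}{\Longrightarrow}p''\stackrel{\alpha}{\dashrightarrow}p'$. $p\sqsubseteq_{\mathrm{MIA}}q$ iff some $\mathcal R\subseteq P\times Q$ containing $(p,q)$ satisfies for all $(p,q)\in\mathcal R$: (i) $q\xrightarrow{a}Q'$ ($a\in I\cup O$) implies some $p\xrightarrow{a}P'$ with $\forall p'\in P'\,\exists q'\in Q'.\,(p',q')\in\mathcal R$; (ii) $p\stackrel{\alpha}{\dashrightarrow}p'$, $\alpha\in O\cup\{\tau\}$, implies some $q\stackrel{\hat\alpha}{\Longrightarrow}q'$ with $(p',q')\in\mathcal R$. Embedding: for an IA $P$, $[\![P]\!]$ is the MIA $(P,I,O,\longrightarrow,\dashrightarrow)$ with $p\xrightarrow{i}p'$ (must) iff $p\xrightarrow{i}_Pp'$ and $i\in I$, and $p\stackrel{\alpha}{\dashrightarrow}p'$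 iff $p\xrightarrow{\alpha}_Pp'$ for $\alpha\in I\cup O\cup\{\tau\}$; $[\![p]\!]$ denotes $p$ as a state of $[\![P]\!]$. *)

(* Defs.v *)
From Stdlib Require Import Relation_Operators.
From mathcomp Require Import all_boot.
From mathcomp Require Import boolp classical_sets.

Set Implicit Arguments.
Unset Strict Implicit.
Unset Printing Implicit Defensive.

Local Open Scope classical_set_scope.

(* Visible actions live in a type [A]; transition labels live in [option A],
   with [None] standing for tau, so that tau lies in no alphabet. *)

Record IA (A : Type) (I O : set A) := MkIA {
  ia_state :> Type;
  ia_trans : ia_state -> option A -> ia_state -> Prop;
  ia_disjoint : I `&` O = set0;
  ia_trans_label : forall p a p', ia_trans p (Some a) p' -> (I `|` O) a;
  ia_input_det : forall a p p' p'', I a ->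
    ia_trans p (Some a) p' -> ia_trans p (Some a) p'' -> p' = p''
}.

Arguments ia_trans {A I O} i _ _ _.

Record MIA (A : Type) (I O : set A) := MkMIA {
  mia_state :> Type;
  mia_must : mia_state -> A -> set mia_state -> Prop;
  mia_may : mia_state -> option A -> mia_state -> Prop;
  mia_disjoint : I `&` O = set0;
  mia_must_label : forall p a P', mia_must p a P' -> (I `|` O) a;
  mia_must_nonempty : forall p a P', mia_must p a P' -> P' !=set0;
  mia_may_label : forall p a p', mia_may p (Some a) p' -> (I `|` O) a;
  mia_syntactic_consistency : forall p a P', mia_must p a P' ->
    forall p', P' p' -> mia_may p (Some a) p';
  mia_input_must_unique : forall i p P' P'', I i ->
    mia_must p i P' -> mia_must p i P'' -> P' = P'';
  mia_input_may_must : forall i p p', I i ->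
    mia_may p (Some i) p' -> exists2 P', mia_must p i P' & P' p'
}.

Arguments mia_must {A I O} m _ _ _.
Arguments mia_may {A I O} m _ _ _.

(* Weak transitions of a relation [tr], which is [ia_trans P] for an IA and
   [mia_may P] for an MIA. *)

Definition weak_eps (A S : Type) (tr : S -> option A -> S -> Prop) :
    S -> S -> Prop :=
  clos_refl_trans S (fun p p' => tr p None p').

Definition weak_step (A S : Type) (tr : S -> option A -> S -> Prop)
    (p : S) (alpha : option A) (p' : S) : Prop :=
  exists2 p'', weak_eps tr p p'' & tr p'' alpha p'.

(* The weak transition labelled by alpha-hat. *)
Definition weak_hat (A S : Type) (tr : S -> option A -> S -> Prop)
    (p : S) (alpha : option A) (p' : S) : Prop :=
  if alpha is Some a then weak_step tr p (Some a) p' else weak_eps tr p p'.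

Definition out_or_tau (A : Type) (O : set A) : set (option A) :=
  fun alpha => if alpha is Some a then O a else True.

Definition IA_refinement (A : Type) (I O : set A) (P Q : IA I O)
    (R : P -> Q -> Prop) : Prop :=
  forall p q, R p q ->
    (forall a q', I a -> ia_trans Q q (Some a) q' ->
       exists2 p', ia_trans P p (Some a) p' & R p' q') /\
    (forall alpha p', out_or_tau O alpha -> ia_trans P p alpha p' ->
       exists2 q', weak_hat (ia_trans Q) q alpha q' & R p' q').

Definition IA_refines (A : Type) (I O : set A) (P Q : IA I O)
    (p : P) (q : Q) : Prop :=
  exists2 R : P -> Q -> Prop, IA_refinement R & R p q.

Definition MIA_refinement (A : Type) (I O : set A) (P Q : MIA I O)
    (R : P -> Q -> Prop) : Prop :=
  forall p q, R p q ->
    (forall a Q', (I `|` O) a -> mia_must Q q a Q' ->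
       exists2 P', mia_must P p a P' &
         forall p', P' p' -> exists2 q', Q' q' & R p' q') /\
    (forall alpha p', out_or_tau O alpha -> mia_may P p alpha p' ->
       exists2 q', weak_hat (mia_may Q) q alpha q' & R p' q').

Definition MIA_refines (A : Type) (I O : set A) (P Q : MIA I O)
    (p : P) (q : Q) : Prop :=
  exists2 R : P -> Q -> Prop, MIA_refinement R & R p q.

Section Embedding.

Variables (A : Type) (I O : set A) (P : IA I O).

Definition embed_must (p : P) (i : A) (P' : set P) : Prop :=
  I i /\ exists2 p', ia_trans P p (Some i) p' & P' = [set p'].

Fact embed_must_label p a P' : embed_must p a P' -> (I `|` O) a.
Proof. by case=> Ia _; left. Qed.

Fact embed_must_nonempty p a P' : embed_must p a P' -> P' !=set0.
Proof. by case=> _ [p' _ ->]; exists p'. Qed.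

Fact embed_syntactic_consistency p a P' : embed_must p a P' ->
  forall p', P' p' -> ia_trans P p (Some a) p'.
Proof. by case=> _ [p' pp' ->] _ ->. Qed.

Fact embed_input_must_unique i p P' P'' : I i ->
  embed_must p i P' -> embed_must p i P'' -> P' = P''.
Proof.
move=> Ii [_ [p' pp' ->]] [_ [p'' pp'' ->]].
by rewrite (ia_input_det Ii pp' pp'').
Qed.

Fact embed_input_may_must i p p' : I i ->
  ia_trans P p (Some i) p' -> exists2 P', embed_must p i P' & P' p'.
Proof. by move=> Ii pp'; exists [set p'] => //; split=> //; exists p'. Qed.

Definition embed : MIA I O :=
  MkMIA (ia_disjoint P) embed_must_label embed_must_nonempty
    (@ia_trans_label _ _ _ P) embed_syntactic_consistency
    embed_input_must_unique embed_input_may_must.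

Definition embed_state (p : P) : embed := p.

End Embedding.

(* Main.v *)
(* Must-transitions of an embedded IA are exactly its input transitions, with
   singleton targets, and its may-transitions are all its transitions; hence
   a relation is an IA-refinement iff it is an MIA-refinement of the
   embeddings. *)
Require Import Defs.
From mathcomp Require Import all_boot.
From mathcomp Require Import boolp classical_sets.

Lemma IA_refinement_embed (A : Type) (I O : set A) (P Q : IA I O)
    (R : P -> Q -> Prop) :
  IA_refinement R <-> @MIA_refinement A I O (embed P) (embed Q) R.
Proof.
(* [mia_may] of an embedding reduces to [ia_trans], so the output and tau clauses agree by
   conversion and [//] closes them; only the must clauses remain. *)
split=> refR p q Rpq; have [must_R may_R] := refR p q Rpq; split=> //.
- move=> a Q' _ [Ia [q' qq' ->]].
  have [p' pp' Rp'q'] := must_R a q' Ia qq'.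
  exists (set1 p'); first by split=> //; exists p'.
  by move=> _ ->; exists q'.
- move=> a q' Ia qq'.
  (* The answering [P'] is itself a singleton, so matching its only element gives the IA answer. *)
  have [|P' [_ [p' pp' ->]] R_P'] := must_R a (set1 q') (or_introl Ia).
    by split=> //; exists q'.
  by have [_ -> Rp'q'] := R_P' p' erefl; exists p'.
Qed.

Theorem theorem4p16 (A : Type) (I O : set A) (P Q : IA I O) (p : P) (q : Q) :
  IA_refines p q <-> MIA_refines (embed_state p) (embed_state q).
Proof.
(* An embedding keeps the states, so the same [R] is a witness on both sides. *)
by split=> -[R refR Rpq]; exists R => //; apply/IA_refinement_embed.
Qed.
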